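(* Let $H$ be a finite-dimensional Hopf algebra and regard $H^*$ as a braided-commutative algebra in the category of right Drinfeld–Yetter modules over $H$ by $a\triangleleft h=\langle a_{(1)},h\rangle a_{(2)}$ and the coaction $\Delta_R$ determined by $(\mathrm{id}\otimes b)(\Delta_Ra)=b_{(1)}a\,S(b_{(2)})$ for $a,b\in H^*$, $h\in H$. Then the group $Z^1_\triangleleft(H,H^* )$ can be identified with the group $G(H^* )$ of counital invertible elements of $H^*$. For any $\alpha\in G(H^* )$, the corresponding 1-cocycle $\varrho_\alpha$ and its associated map $\psi_\alpha$ are given by $$\varrho_\alpha(h)=\langle\alpha_{(1)},h\rangle\,\alpha_{(2)}\alpha^{-1},\qquad \psi_\alpha(a)=\alpha a\alpha^{-1}$$ for all $h\in H$ and $a\in H^*$.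
   Context: Everything is over a field $k$. $H^*$ is the dual Hopf algebra, with $\langle ab,h\rangle=\langle a,h_{(1)}\rangle\langle b,h_{(2)}\rangle$ and $\langle a,hg\rangle=\langle a_{(1)},h\rangle\langle a_{(2)},g\rangle$. An element $\alpha\in H^*$ is counital if $\varepsilon(\alpha)=\alpha(1)=1$; $G(H^* )$ is the group of counital invertible elements under the product of $H^*$. A right Drinfeld–Yetter module over $H$ is a vector space $B$ with a right $H$-action $\triangleleft$ and a right $H$-coaction $\Delta_Rb=b_{(0)}\otimes b_{(1)}$ such that $(b\triangleleft h_{(2)})_{(0)}\otimes h_{(1)}(b\triangleleft h_{(2)})_{(1)}=b_{(0)}\triangleleft h_{(1)}\otimes b_{(1)}h_{(2)}$. A braided-commutative algebra in this category is such a $B$ that is an algebra which is a right $H$-module algebra and a right $H$-comodule algebra with $ab=b_{(0)}(a\triangleleft b_{(1)})$ for all $a,b$. For a braided-commutative algebra $B$ in this category, $Z^1_\triangleleft(H,B)$ is the group of unital linear maps $\varrho:H\to B$ with $\varrho(gh)=(\varrho(g)\triangleleft h_{(1)})\varrho(h_{(2)})$ for all $g,h\in H$ and such that $\psi(b)=b_{(0)}\varrho(b_{(1)})$ is an invertible map $B\to B$, with product $(\varrho\bullet\varrho')(h)=\varrho(h_{(1)})\psi(\varrho'(h_{(2)}))$, $\psi$ being the map associated to $\varrho$. *)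

(* Defs.v *)
From HB Require Import structures.
From mathcomp Require Import all_boot all_order all_algebra all_field.
From mathcomp Require Import boolp.

Set Implicit Arguments.
Unset Strict Implicit.
Unset Printing Implicit Defensive.

Import GRing.Theory.
Local Open Scope ring_scope.

Reserved Notation "x ⊗ y" (at level 40, left associativity).
Reserved Notation "\sw_ ( x , y <- t ) E"
  (at level 41, E at level 41, x name, y name, t at level 50,
   format "'[' \sw_ ( x ,  y  <-  t ) '/  '  E ']'").

(* V (x) W for an arbitrary vector space V and a finite-dimensional W: a tensor
   is the family of its components along the basis [vbasis {:W}] of W.  *)
Definition tens (K : fieldType) (V : lmodType K) (W : vectType K) : Type :=
  {ffun 'I_(\dim {:W}) -> V}.
HB.instance Definition _ (K : fieldType) (V : lmodType K) (W : vectType K) :=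
  GRing.Lmodule.copy (tens V W) {ffun 'I_(\dim {:W}) -> V}.

Section Tensor.
Variables (K : fieldType) (V : lmodType K) (W : vectType K).

Definition pure (v : V) (w : W) : tens V W :=
  [ffun i => coord (vbasis {:W}) i w *: v].

(* The image of t under the linear map V (x) W -> X induced by a bilinear
   f : V -> W -> X (universal property; see [swd_pure]).  It renders Sweedler
   notation: an expression E bilinear in t = t_(1) (x) t_(2) is written
   [\sw_(t1, t2 <- t) E]. *)
Definition swd (X : lmodType K) (t : tens V W) (f : V -> W -> X) : X :=
  \sum_i f (t i) (vbasis {:W})`_i.
End Tensor.

Notation "x ⊗ y" := (pure x y) : ring_scope.
Notation "\sw_ ( x , y <- t ) E" := (swd t (fun x y => E)) : ring_scope.

Section Linear.
Variable (K : fieldType).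
Implicit Types (X Y Z V : lmodType K) (W : vectType K).

Lemma lin_id X : linear (fun x : X => x). Proof. by []. Qed.

Lemma lin_comp X Y Z (f : Y -> Z) (g : X -> Y) :
  linear f -> linear g -> linear (fun x => f (g x)).
Proof. by move=> lf lg a u v; rewrite /= lg lf. Qed.

Lemma lin0 X Y (f : X -> Y) : linear f -> f 0 = 0.
Proof. by move=> lf; have := lf (-1) 0 0; rewrite scaleN1r addNr scaleN1r addNr. Qed.

Lemma linD X Y (f : X -> Y) : linear f -> {morph f : x y / x + y}.
Proof. by move=> lf x y; have := lf 1 x y; rewrite !scale1r. Qed.

Lemma linZ X Y (f : X -> Y) : linear f -> forall a x, f (a *: x) = a *: f x.
Proof. by move=> lf a x; have := lf a x 0; rewrite !addr0 lin0 // addr0. Qed.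

Lemma lin_sum X Y (f : X -> Y) : linear f ->
  forall (I : finType) (F : I -> X), f (\sum_i F i) = \sum_i f (F i).
Proof.
by move=> lf I F; rewrite (big_morph f (linD lf) (lin0 lf)).
Qed.

Lemma lin_swt V W X Y (T : X -> tens V W) (f : V -> W -> Y) :
  linear T -> (forall w, linear (fun x => f x w)) -> linear (fun x => swd (T x) f).
Proof.
move=> lT lf a u v; rewrite /swd scaler_sumr -big_split; apply: eq_bigr => i _.
by rewrite lT !ffunE lf.
Qed.

Lemma lin_swf V W X Y (t : tens V W) (f : X -> V -> W -> Y) :
  (forall v w, linear (fun x => f x v w)) -> linear (fun x => swd t (f x)).
Proof.
move=> lf a u v; rewrite /swd scaler_sumr -big_split; apply: eq_bigr => i _.
by rewrite lf.
Qed.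

Lemma lin_mulr X (A : algType K) (a : A) (g : X -> A) :
  linear g -> linear (fun x => a * g x).
Proof. by move=> lg c u v; rewrite lg mulrDr scalerAr. Qed.

Lemma lin_mull X (A : algType K) (a : A) (g : X -> A) :
  linear g -> linear (fun x => g x * a).
Proof. by move=> lg c u v; rewrite lg mulrDl scalerAl. Qed.

Lemma lin_scaler X Y (a : K) (g : X -> Y) :
  linear g -> linear (fun x => a *: g x).
Proof. by move=> lg c u v; rewrite lg scalerDr !scalerA mulrC. Qed.

Lemma lin_scalel X Y (g : X -> K^o) (y : Y) :
  linear g -> linear (fun x => (g x : K) *: y).
Proof. by move=> lg c u v; rewrite lg scalerDl scalerA. Qed.

Lemma lin_purel X V W (g : X -> V) (w : W) :
  linear g -> linear (fun x => g x ⊗ w).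
Proof.
move=> lg c u v; apply/ffunP => i.
by rewrite !ffunE lg scalerDr !scalerA mulrC.
Qed.

Lemma lin_purer X V W (v : V) (g : X -> W) :
  linear g -> linear (fun x => v ⊗ g x).
Proof.
by move=> lg c x y; apply/ffunP => i; rewrite !ffunE lg linearP scalerDl scalerA.
Qed.

Lemma lin_lfun (U W : vectType K) (X : lmodType K) (a : 'Hom(U, W)) (g : X -> U) :
  linear g -> linear (fun x => a (g x)).
Proof. by move=> lg c u v; rewrite lg linearP. Qed.

Lemma lin_lfunl (U W : vectType K) (X : lmodType K) (g : X -> 'Hom(U, W)) u :
  linear g -> linear (fun x => g x u).
Proof. by move=> lg c x y; rewrite lg !lfunE /= !lfunE. Qed.

Lemma linfunE (U W : vectType K) (f : U -> W) : linear f -> linfun f =1 f.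
Proof.
move=> lf x.
pose m := GRing.isLinear.Build K U W _ f lf.
pose F : {linear U -> W} := HB.pack f m.
exact: (lfunE F).
Qed.

Lemma eq_swd V W X (t : tens V W) (f g : V -> W -> X) : f =2 g -> swd t f = swd t g.
Proof. by move=> fg; apply: eq_bigr => i _. Qed.

Lemma swd_pure V W X (f : V -> W -> X) v w :
  (forall w, linear (fun v => f v w)) -> (forall v, linear (f v)) ->
  \sw_(x, y <- v ⊗ w) f x y = f v w.
Proof.
move=> lf1 lf2; rewrite /swd {2}(coord_vbasis (memvf w)) (lin_sum (lf2 v)).
by apply: eq_bigr => i _; rewrite ffunE (linZ (lf1 _)) (linZ (lf2 _)).
Qed.

Lemma swd_id V W (t : tens V W) : \sw_(x, y <- t) x ⊗ y = t.
Proof.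
apply/ffunP => i; rewrite /swd sum_ffunE (bigD1 i) //= big1 ?addr0.
  by rewrite ffunE coord_free ?(basis_free (vbasisP _)) // eqxx scale1r.
move=> j ji; rewrite ffunE coord_free ?(basis_free (vbasisP _)) //.
by rewrite (negPf ji) scale0r.
Qed.

Lemma lin_sw V W X Y (g : X -> Y) (t : tens V W) (f : V -> W -> X) :
  linear g -> g (swd t f) = \sw_(x, y <- t) g (f x y).
Proof. by move=> lg; rewrite /swd lin_sum. Qed.

Lemma sw_exch V W V' W' X (s : tens V W) (t : tens V' W')
    (f : V -> W -> V' -> W' -> X) :
  \sw_(x, y <- s) \sw_(u, v <- t) f x y u v =
  \sw_(u, v <- t) \sw_(x, y <- s) f x y u v.
Proof. exact: exchange_big. Qed.

Lemma tens_ext V W (s t : tens V W) :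
  (forall c : W -> K^o, linear c ->
     \sw_(x, y <- s) (c y : K) *: x = \sw_(x, y <- t) (c y : K) *: x) -> s = t.
Proof.
move=> st; apply/ffunP => i.
have := st (coord (vbasis {:W}) i) (fun a u v => linearP _ a u v).
have E r : \sw_(x, y <- r) (coord (vbasis {:W}) i y : K) *: x = (r : tens V W) i.
  rewrite /swd (bigD1 i) //= big1 ?addr0.
    by rewrite coord_free ?(basis_free (vbasisP _)) // eqxx scale1r.
  move=> j ji; rewrite coord_free ?(basis_free (vbasisP _)) //.
  by rewrite (negPf ji) scale0r.
by rewrite !E.
Qed.
End Linear.

HB.mixin Record isHopf (K : fieldType) H of Falgebra K H := {
  comul : H -> tens H H;
  counit : H -> K;
  antipode : H -> H;
  comul_lin : linear comul;
  counit_lin : linear (counit : H -> K^o);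
  antipode_lin : linear antipode;
  comulA : forall h, \sw_(h1, h2 <- comul h) (comul h1 ⊗ h2) =
    \sw_(h1, h2 <- comul h) \sw_(h3, h4 <- comul h2) (h1 ⊗ h3) ⊗ h4;
  counitl : forall h, \sw_(h1, h2 <- comul h) counit h1 *: h2 = h;
  counitr : forall h, \sw_(h1, h2 <- comul h) counit h2 *: h1 = h;
  comul1 : comul 1 = 1 ⊗ 1;
  comulM : forall g h, comul (g * h) =
    \sw_(g1, g2 <- comul g) \sw_(h1, h2 <- comul h) (g1 * h1) ⊗ (g2 * h2);
  counit1 : counit 1 = 1;
  counitM : forall g h, counit (g * h) = counit g * counit h;
  antipodel : forall h,
    \sw_(h1, h2 <- comul h) antipode h1 * h2 = counit h *: (1 : H);
  antipoder : forall h,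
    \sw_(h1, h2 <- comul h) h1 * antipode h2 = counit h *: (1 : H)
}.

#[short(type="finHopfType")]
HB.structure Definition FinHopf (K : fieldType) :=
  { H of Falgebra K H & isHopf K H }.

(* Linearity of an expression in one of its variables, by congruence. *)
Ltac lin_step_ext := fail.
Ltac lin_step := lazymatch goal with
  | |- linear ?f => match f with
    | (fun x => x) => exact: lin_id
    | (fun x => swd ?t (@?f x)) => refine (@lin_swf _ _ _ _ _ t f _); move=> ? ?
    | (fun x => swd (@?t x) ?f) => refine (@lin_swt _ _ _ _ _ t f _ _); [|move=> ?]
    | (fun x => pure ?a (@?g x)) => refine (@lin_purer _ _ _ _ a g _)
    | (fun x => pure (@?g x) ?a) => refine (@lin_purel _ _ _ _ g a _)
    | (fun x => ?a *: (@?g x)) => refine (@lin_scaler _ _ _ a g _)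
    | (fun x => (@?g x) *: ?a) => refine (@lin_scalel _ _ _ g a _)
    | (fun x => ?a * (@?g x)) => refine (@lin_mulr _ _ _ a g _)
    | (fun x => (@?g x) * ?a) => refine (@lin_mull _ _ _ a g _)
    | (fun x => comul (@?g x)) => refine (@lin_comp _ _ _ _ comul g comul_lin _)
    | (fun x => counit (@?g x)) => refine (@lin_comp _ _ _ _ _ g (@counit_lin _ _) _)
    | (fun x => antipode (@?g x)) => refine (@lin_comp _ _ _ _ antipode g antipode_lin _)
    | (fun x => fun_of_lfun ?a (@?g x)) => refine (@lin_lfun _ _ _ _ a g _)
    | (fun x => fun_of_lfun (@?g x) ?a) => refine (@lin_lfunl _ _ _ _ g a _)
    | (fun x => ?h (@?g x)) =>
        match goal with H : linear h |- _ => refine (@lin_comp _ _ _ _ h g H _) end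
    | (fun x => ?h (@?g x) ?y) =>
        match goal with H : forall y, linear (fun x => h x y) |- _ =>
          refine (@lin_comp _ _ _ _ (fun x => h x y) g (H y) _) end
    | (fun x => ?h (@?g x) ?y) =>
        match goal with H : forall y, linear (fun x => h x y) |- _ =>
          refine (@lin_comp _ _ _ _ (fun x => h x y) g (H y) _) end
    | (fun x => ?h ?y (@?g x)) =>
        match goal with H : forall y, linear (h y) |- _ =>
          refine (@lin_comp _ _ _ _ (h y) g (H y) _) end
    | (fun x => ?h (@?g x) ?y ?z) =>
        match goal with H : forall y z, linear (fun x => h x y z) |- _ =>
          refine (@lin_comp _ _ _ _ (fun x => h x y z) g (H y z) _) end
    | (fun x => ?h ?y (@?g x) ?z) =>
        match goal with H : forall y z, linear (fun x => h y x z) |- _ =>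
          refine (@lin_comp _ _ _ _ (fun x => h y x z) g (H y z) _) end
    | (fun x => ?h ?y ?z (@?g x)) =>
        match goal with H : forall y z, linear (fun x => h y z x) |- _ =>
          refine (@lin_comp _ _ _ _ (fun x => h y z x) g (H y z) _) end
    | (fun x => ?h (@?g x) ?y ?z ?w) =>
        match goal with H : forall y z w, linear (fun x => h x y z w) |- _ =>
          refine (@lin_comp _ _ _ _ (fun x => h x y z w) g (H y z w) _) end
    | (fun x => ?h ?y (@?g x) ?z ?w) =>
        match goal with H : forall y z w, linear (fun x => h y x z w) |- _ =>
          refine (@lin_comp _ _ _ _ (fun x => h y x z w) g (H y z w) _) end
    | (fun x => ?h ?y ?z (@?g x) ?w) =>
        match goal with H : forall y z w, linear (fun x => h y z x w) |- _ =>
          refine (@lin_comp _ _ _ _ (fun x => h y z x w) g (H y z w) _) end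
    | (fun x => ?h ?y ?z ?w (@?g x)) =>
        match goal with H : forall y z w, linear (fun x => h y z w x) |- _ =>
          refine (@lin_comp _ _ _ _ (fun x => h y z w x) g (H y z w) _) end
    | fun_of_lfun ?a => exact: (lin_lfun a (@lin_id _ _))
    | _ => assumption
    end
  end.
Ltac lin_intro := lazymatch goal with |- linear _ => fail | |- _ => intro end.
Ltac lin := repeat lin_intro; cbv beta;
  repeat (first [lin_step | lin_step_ext]; repeat lin_intro; cbv beta).

Section SweedlerMul.
Variables (K : fieldType) (V : lmodType K) (W : vectType K) (A : algType K).
Implicit Types (t : tens V W) (f : V -> W -> A).

Lemma mulr_swr (a : A) t f : a * swd t f = \sw_(x, y <- t) a * f x y.
Proof. by apply: (lin_sw (g := fun z => a * z)); lin. Qed.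

Lemma mulr_swl (a : A) t f : swd t f * a = \sw_(x, y <- t) f x y * a.
Proof. by apply: (lin_sw (g := fun z => z * a)); lin. Qed.

Lemma scaler_sw (X : lmodType K) (a : K) t (f : V -> W -> X) :
  a *: swd t f = \sw_(x, y <- t) a *: f x y.
Proof. by apply: (lin_sw (g := fun z => a *: z)); lin. Qed.

Lemma lfun_sw (U Y : vectType K) (F : 'Hom(U, Y)) t (f : V -> W -> U) :
  F (swd t f) = \sw_(x, y <- t) F (f x y).
Proof. by apply: (lin_sw (g := fun z => F z)); lin. Qed.

Lemma sw_lfun (U Y : vectType K) (h : U) t (f : V -> W -> 'Hom(U, Y)) :
  swd t f h = \sw_(x, y <- t) f x y h.
Proof. by apply: (lin_sw (g := fun z : 'Hom(U, Y) => z h)); lin. Qed.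

Lemma pure_swl (X : lmodType K) (U : vectType K) t (f : V -> W -> X) (u : U) :
  swd t f ⊗ u = \sw_(x, y <- t) f x y ⊗ u.
Proof. by apply: (lin_sw (g := fun z => z ⊗ u)); lin. Qed.

Lemma pure_swr (X : lmodType K) (U : vectType K) t (f : V -> W -> U) (x : X) :
  x ⊗ swd t f = \sw_(v, w <- t) x ⊗ f v w.
Proof. by apply: (lin_sw (g := fun z => x ⊗ z)); lin. Qed.

Lemma sw_sw (V' : lmodType K) (W' : vectType K) (X : lmodType K) t
    (T : V -> W -> tens V' W') (f : V' -> W' -> X) :
  (forall w, linear (fun v => f v w)) ->
  swd (swd t T) f = \sw_(x, y <- t) swd (T x y) f.
Proof. by move=> lf; apply: (lin_sw (g := fun z => swd z f)); lin. Qed.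
End SweedlerMul.

Section HopfTheory.
Variables (K : fieldType) (H : finHopfType K).
Implicit Types (g h : H).

Lemma coassocS (X : lmodType K) (F : H -> H -> H -> X) h :
  (forall y z, linear (fun x => F x y z)) ->
  (forall y z, linear (fun x => F y x z)) ->
  (forall y z, linear (fun x => F y z x)) ->
  \sw_(h1, h2 <- comul h) \sw_(x, y <- comul h1) F x y h2 =
  \sw_(h1, h2 <- comul h) \sw_(x, y <- comul h2) F h1 x y.
Proof.
move=> l1 l2 l3.
pose Phi (t : tens (tens H H) H) := \sw_(s, z <- t) \sw_(x, y <- s) F x y z.
have lP : linear Phi by rewrite /Phi; lin.
have := congr1 Phi (comulA h).
rewrite (lin_sw _ _ lP).
have E1 x y : Phi (comul x ⊗ y) = \sw_(u, v <- comul x) F u v y.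
  rewrite /Phi swd_pure //; by lin.
under eq_swd => x y do rewrite E1.
move=> ->; rewrite (lin_sw _ _ lP); apply: eq_swd => x y.
rewrite (lin_sw _ _ lP); apply: eq_swd => u v.
rewrite /Phi swd_pure; try by lin.
rewrite swd_pure //; try by lin.
Qed.

Lemma coassocS4 (X : lmodType K) (F : H -> H -> H -> H -> X) h :
  (forall y z w, linear (fun x => F x y z w)) ->
  (forall y z w, linear (fun x => F y x z w)) ->
  (forall y z w, linear (fun x => F y z x w)) ->
  (forall y z w, linear (fun x => F y z w x)) ->
  \sw_(h1, h2 <- comul h) \sw_(x, y <- comul h1) \sw_(z, w <- comul h2) F x y z w =
  \sw_(x, h2 <- comul h) \sw_(k, w <- comul h2) \sw_(y, z <- comul k) F x y z w.
Proof.
move=> l1 l2 l3 l4.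
rewrite (coassocS (F := fun x y k => \sw_(z, w <- comul k) F x y z w)); try by lin.
by apply: eq_swd => x k; rewrite -(coassocS (F := F x)); lin.
Qed.

Lemma counitlS (X : lmodType K) (f : H -> X) h : linear f ->
  \sw_(h1, h2 <- comul h) counit h1 *: f h2 = f h.
Proof.
move=> lf; rewrite -[in RHS](counitl h) (lin_sw _ _ lf).
by apply: eq_swd => x y; rewrite linZ.
Qed.

Lemma counitrS (X : lmodType K) (f : H -> X) h : linear f ->
  \sw_(h1, h2 <- comul h) counit h2 *: f h1 = f h.
Proof.
move=> lf; rewrite -[in RHS](counitr h) (lin_sw _ _ lf).
by apply: eq_swd => x y; rewrite linZ.
Qed.

Lemma comulMS (X : lmodType K) (F : H -> H -> X) g h :
  (forall y, linear (fun x => F x y)) -> (forall y, linear (F y)) ->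
  \sw_(x, y <- comul (g * h)) F x y =
  \sw_(g1, g2 <- comul g) \sw_(h1, h2 <- comul h) F (g1 * h1) (g2 * h2).
Proof.
move=> l1 l2; rewrite comulM.
pose Phi (t : tens H H) := \sw_(x, y <- t) F x y.
have lP : linear Phi by rewrite /Phi; lin.
rewrite -/(Phi _) (lin_sw _ _ lP); apply: eq_swd => x y.
rewrite (lin_sw _ _ lP); apply: eq_swd => u v.
by rewrite /Phi swd_pure; lin.
Qed.
End HopfTheory.

Section Antipode.
Variables (K : fieldType) (H : finHopfType K).
Implicit Types (g h : H).

(* Uniqueness of inverses in the convolution algebra of bilinear maps. *)
Lemma conv_inv_uniq (A : algType K) (F P G : H -> H -> A) :
  (forall y, linear (fun x => F x y)) -> (forall y, linear (F y)) ->
  (forall y, linear (fun x => P x y)) -> (forall y, linear (P y)) ->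
  (forall y, linear (fun x => G x y)) -> (forall y, linear (G y)) ->
  (forall g h, \sw_(g1, g2 <- comul g) \sw_(h1, h2 <- comul h)
     F g1 h1 * P g2 h2 = counit g *: (counit h *: (1 : A))) ->
  (forall g h, \sw_(g1, g2 <- comul g) \sw_(h1, h2 <- comul h)
     P g1 h1 * G g2 h2 = counit g *: (counit h *: (1 : A))) ->
  F =2 G.
Proof.
move=> lF1 lF2 lP1 lP2 lG1 lG2 FP PG g h.
transitivity (\sw_(g1, g2 <- comul g) \sw_(h1, h2 <- comul h)
   F g1 h1 * (\sw_(g3, g4 <- comul g2) \sw_(h3, h4 <- comul h2) P g3 h3 * G g4 h4)).
  rewrite -(counitrS (f := fun x => F x h)) //; apply: eq_swd => g1 g2.
  rewrite -(counitrS (f := F g1)) // (lin_sw _ (fun x y => counit y *: F g1 x)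
    (g := fun z => counit g2 *: z)); last by lin.
  by apply: eq_swd => h1 h2; rewrite PG -!scalerAr mulr1.
transitivity (\sw_(g1, g2 <- comul g) \sw_(h1, h2 <- comul h)
   \sw_(g3, g4 <- comul g1) \sw_(h3, h4 <- comul h1) F g3 h3 * P g4 h4 * G g2 h2).
  rewrite sw_exch [RHS]sw_exch.
  transitivity (\sw_(h1, h2 <- comul h) \sw_(h3, h4 <- comul h2)
     \sw_(g1, g2 <- comul g) \sw_(g3, g4 <- comul g2)
     F g1 h1 * P g3 h3 * G g4 h4).
    apply: eq_swd => h1 h2; rewrite [RHS]sw_exch; apply: eq_swd => g1 g2.
    rewrite (lin_sw _ _ (g := fun z => F g1 h1 * z)); last by lin.
    rewrite [RHS]sw_exch; apply: eq_swd => g3 g4.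
    rewrite (lin_sw _ _ (g := fun z => F g1 h1 * z)); last by lin.
    by apply: eq_swd => h3 h4; rewrite mulrA.
  rewrite -(coassocS (F := fun h1 h3 h4 => \sw_(g1, g2 <- comul g)
    \sw_(g3, g4 <- comul g2) F g1 h1 * P g3 h3 * G g4 h4)); try by lin.
  apply: eq_swd => h1 h2.
  under [RHS]eq_swd => g1 g2 do rewrite sw_exch.
  rewrite [RHS]sw_exch; apply: eq_swd => h3 h4.
  by rewrite -(coassocS (F := fun g1 g3 g4 => F g1 h3 * P g3 h4 * G g4 h2)); lin.
rewrite -(counitlS (f := fun x => G x h)) //; apply: eq_swd => g1 g2.
rewrite -(counitlS (f := G g2)) // (lin_sw _ (fun x y => counit x *: G g2 y)
    (g := fun z => counit g1 *: z)); last by lin.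
apply: eq_swd => h1 h2; rewrite -[G g2 h2 in RHS]mul1r !scalerAl -FP.
rewrite (lin_sw _ _ (g := fun z => z * G g2 h2)); last by lin.
apply: eq_swd => g3 g4.
by rewrite (lin_sw _ _ (g := fun z => z * G g2 h2)) //; lin.
Qed.

Lemma antipode1 : antipode (1 : H) = 1.
Proof.
have := antipodel (1 : H); rewrite comul1 counit1 scale1r swd_pure; try by lin.
by rewrite mulr1.
Qed.

Lemma antipodeM g h : antipode (g * h) = antipode h * antipode g.
Proof.
apply: (@conv_inv_uniq H (fun g h => antipode (g * h)) (fun g h => g * h)
  (fun g h => antipode h * antipode g)) => [||||||x y|x y]; try by lin.
- transitivity (\sw_(a, b <- comul (x * y)) antipode a * b).
    by rewrite comulMS //; lin.
  by rewrite antipodel counitM scalerA.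
- transitivity (\sw_(g1, g2 <- comul x) (g1 * (counit y *: 1)) * antipode g2).
    apply: eq_swd => g1 g2; rewrite -antipoder.
    rewrite (lin_sw _ _ (g := fun z => g1 * z * antipode g2)); last by lin.
    by apply: eq_swd => h1 h2; rewrite !mulrA.
  under eq_swd => g1 g2 do rewrite -scalerAr mulr1 -scalerAl.
  rewrite -(lin_sw _ _ (g := fun z => counit y *: z)); last by lin.
  by rewrite antipoder !scalerA mulrC.
Qed.
End Antipode.

(* The dual Hopf algebra H^*, with < a, h > written [a h]. *)
Definition hdual (K : fieldType) (H : finHopfType K) : Type := 'Hom(H, K^o).
HB.instance Definition _ (K : fieldType) (H : finHopfType K) :=
  Vector.copy (hdual H) 'Hom(H, K^o).

Section Dual.
Variables (K : fieldType) (H : finHopfType K).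
Implicit Types (g h : H) (a b c : hdual H).

Definition hdual_mul a b : hdual H :=
  linfun (fun h => \sw_(h1, h2 <- comul h) (a h1 * b h2 : K^o)).
Definition hdual_one : hdual H := linfun (fun h => counit h : K^o).

(* [hdual_evr h a] is a_(2) < a_(1), h >, [hdual_evl g a] is a_(1) < a_(2), g >. *)
Definition hdual_evr h a : hdual H := linfun (fun x => a (h * x)).
Definition hdual_evl g a : hdual H := linfun (fun x => a (x * g)).
Definition dual_basis (i : 'I_(\dim {:H})) : hdual H :=
  linfun (fun x => coord (vbasis {:H}) i x : K^o).
Definition hdual_comul a : tens (hdual H) (hdual H) :=
  \sum_(i < \dim {:H}) hdual_evl (vbasis {:H})`_i a ⊗ dual_basis i.
Definition hdual_counit a : K := a 1.
Definition hdual_antipode a : hdual H := linfun (fun h => a (antipode h)).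

Lemma hdual_mulE a b h : hdual_mul a b h = \sw_(h1, h2 <- comul h) (a h1 * b h2 : K^o).
Proof. by rewrite /hdual_mul linfunE //; lin. Qed.
Lemma hdual_oneE h : hdual_one h = counit h.
Proof. by rewrite /hdual_one linfunE //; exact: counit_lin. Qed.
Lemma hdual_evrE h a x : hdual_evr h a x = a (h * x).
Proof. by rewrite /hdual_evr linfunE //; lin. Qed.
Lemma hdual_evlE g a x : hdual_evl g a x = a (x * g).
Proof. by rewrite /hdual_evl linfunE //; lin. Qed.
Lemma hdual_antipodeE a h : hdual_antipode a h = a (antipode h).
Proof. by rewrite /hdual_antipode linfunE //; lin. Qed.
Lemma dual_basisE i x : dual_basis i x = coord (vbasis {:H}) i x.
Proof. by rewrite /dual_basis linfunE // => u v w; rewrite linearP. Qed.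

Lemma hdual_mulA : associative hdual_mul.
Proof.
move=> a b c; apply/lfunP => h; rewrite !hdual_mulE.
under eq_swd => h1 h2 do rewrite hdual_mulE mulr_swr.
under [RHS]eq_swd => h1 h2 do rewrite hdual_mulE mulr_swl.
rewrite [RHS](coassocS (F := fun x y z => a x * b y * c z : K^o)); try by lin.
by apply: eq_swd => x y; apply: eq_swd => z t; rewrite mulrA.
Qed.

Lemma hdual_mul1l : left_id hdual_one hdual_mul.
Proof.
move=> a; apply/lfunP => h; rewrite hdual_mulE -[RHS](counitlS (f := a)); last by lin.
by apply: eq_swd => x y; rewrite hdual_oneE.
Qed.

Lemma hdual_mul1r : right_id hdual_one hdual_mul.
Proof.
move=> a; apply/lfunP => h; rewrite hdual_mulE -[RHS](counitrS (f := a)); last by lin.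
by apply: eq_swd => x y; rewrite hdual_oneE mulrC.
Qed.

Lemma hdual_mulDl : left_distributive hdual_mul +%R.
Proof.
move=> a b c; apply/lfunP => h; rewrite !lfunE /= !hdual_mulE.
by rewrite -big_split; apply: eq_bigr => i _; rewrite !lfunE /= mulrDl.
Qed.

Lemma hdual_mulDr : right_distributive hdual_mul +%R.
Proof.
move=> a b c; apply/lfunP => h; rewrite !lfunE /= !hdual_mulE.
by rewrite -big_split; apply: eq_bigr => i _; rewrite !lfunE /= mulrDr.
Qed.

Lemma hdual_one_neq0 : hdual_one != 0.
Proof.
apply/eqP => /lfunP /(_ 1) /eqP; rewrite hdual_oneE counit1 lfunE /=.
by rewrite oner_eq0.
Qed.

HB.instance Definition _ := GRing.Zmodule_isNzRing.Build (hdual H)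
  hdual_mulA hdual_mul1l hdual_mul1r hdual_mulDl hdual_mulDr hdual_one_neq0.

Lemma hdual_scaleAl (k : K) (a b : hdual H) : k *: (a * b) = (k *: a) * b.
Proof.
apply/lfunP => h; rewrite lfunE /= !hdual_mulE /swd scaler_sumr; apply: eq_bigr => i _.
by rewrite lfunE /= scalerAl.
Qed.
HB.instance Definition _ := GRing.Lmodule_isLalgebra.Build K (hdual H) hdual_scaleAl.

Lemma hdual_scaleAr (k : K) (a b : hdual H) : k *: (a * b) = a * (k *: b).
Proof.
apply/lfunP => h; rewrite lfunE /= !hdual_mulE /swd scaler_sumr; apply: eq_bigr => i _.
by rewrite lfunE /= scalerAr.
Qed.
HB.instance Definition _ := GRing.Lalgebra_isAlgebra.Build K (hdual H) hdual_scaleAr.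
HB.instance Definition _ := Algebra_isFalgebra.Build K (hdual H).

Lemma hdualME a b h : (a * b) h = \sw_(h1, h2 <- comul h) (a h1 * b h2 : K^o).
Proof. exact: hdual_mulE. Qed.
Lemma hdual1E h : (1 : hdual H) h = counit h.
Proof. exact: hdual_oneE. Qed.
End Dual.

Section DualHopf.
Variables (K : fieldType) (H : finHopfType K).
Implicit Types (g h : H) (a b c : hdual H).

Lemma scale_regE (k : K) (x : K^o) : k *: x = k * x. Proof. by []. Qed.

Lemma lin_hdual_evr h : linear (@hdual_evr K H h).
Proof. by move=> k a b; apply/lfunP => x; rewrite hdual_evrE !add_lfunE !scale_lfunE !hdual_evrE. Qed.
Lemma lin_hdual_evl h : linear (@hdual_evl K H h).
Proof. by move=> k a b; apply/lfunP => x; rewrite hdual_evlE !add_lfunE !scale_lfunE !hdual_evlE. Qed.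

Lemma hdual_decomp a : a = \sum_(i < \dim {:H}) a (vbasis {:H})`_i *: dual_basis i.
Proof.
apply/lfunP => h; rewrite sum_lfunE [in LHS](coord_vbasis (memvf h)) linear_sum.
by apply: eq_bigr => i _; rewrite scale_lfunE dual_basisE linearZ /= !scale_regE mulrC.
Qed.

Lemma lin_hdual_comul : linear (@hdual_comul K H).
Proof.
move=> k a b; rewrite /hdual_comul scaler_sumr -big_split; apply: eq_bigr => i _.
by rewrite lin_hdual_evl; apply: (lin_purel (g := fun z => z) (dual_basis i) (@lin_id _ _)).
Qed.

Lemma tens_hdual_ext (V : lmodType K) (s t : tens V (hdual H)) :
  (forall g, \sw_(x, y <- s) (y g : K) *: x = \sw_(x, y <- t) (y g : K) *: x) ->
  s = t.
Proof.
move=> st; apply: tens_ext => c lc.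
have E (r : tens V (hdual H)) : \sw_(x, y <- r) (c y : K) *: x =
   \sum_(i < \dim {:H}) (c (dual_basis i) : K) *:
       \sw_(x, y <- r) (y (vbasis {:H})`_i : K) *: x.
  rewrite /swd; under [RHS]eq_bigr do rewrite scaler_sumr.
  rewrite exchange_big; apply: eq_bigr => j _ /=.
  rewrite [in LHS](hdual_decomp (vbasis _)`_j) (lin_sum lc) scaler_suml.
  by apply: eq_bigr => i _; rewrite (linZ lc) scalerA mulrC.
by rewrite !E; apply: eq_bigr => i _; rewrite st.
Qed.

Lemma hdual_comul_evr a g : \sw_(a1, a2 <- hdual_comul a) (a2 g : K) *: a1 = hdual_evl g a.
Proof.
have lT : linear (fun t : tens (hdual H) (hdual H) =>
    \sw_(a1, a2 <- t) (a2 g : K) *: a1) by lin.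
rewrite /hdual_comul (lin_sum lT); apply/lfunP => x.
rewrite hdual_evlE sum_lfunE [in RHS](coord_vbasis (memvf g)) mulr_sumr linear_sum.
apply: eq_bigr => i _; rewrite swd_pure; try by lin.
by rewrite dual_basisE scale_lfunE hdual_evlE -scalerAr linearZ.
Qed.

Lemma hdual_comul_evl a h : \sw_(a1, a2 <- hdual_comul a) (a1 h : K) *: a2 = hdual_evr h a.
Proof.
apply/lfunP => x; have := hdual_comul_evr a x => /lfunP /(_ h).
rewrite !sw_lfun hdual_evlE hdual_evrE => <-; apply: eq_swd => u v.
by rewrite !scale_lfunE !scale_regE mulrC.
Qed.

(* < a, h g > = < a_(1), h > < a_(2), g > *)
Lemma hdual_comulE a h g : \sw_(a1, a2 <- hdual_comul a) (a1 h * a2 g : K^o) = a (h * g).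
Proof.
have := hdual_comul_evr a g => /lfunP /(_ h).
rewrite sw_lfun hdual_evlE => <-; apply: eq_swd => u v.
by rewrite scale_lfunE scale_regE mulrC.
Qed.

Lemma tens_hdual2_ext (s t : tens (hdual H) (hdual H)) :
  (forall h g, \sw_(a, b <- s) (a h * b g : K^o) =
     \sw_(a, b <- t) (a h * b g : K^o)) -> s = t.
Proof.
move=> st; apply: tens_hdual_ext => g; apply/lfunP => h; rewrite !sw_lfun.
under eq_swd => a b do rewrite scale_lfunE scale_regE mulrC.
under [RHS]eq_swd => a b do rewrite scale_lfunE scale_regE mulrC.
exact: st.
Qed.

Lemma hdual_comulA a : \sw_(a1, a2 <- hdual_comul a) (hdual_comul a1 ⊗ a2) =
  \sw_(a1, a2 <- hdual_comul a) \sw_(a3, a4 <- hdual_comul a2) (a1 ⊗ a3) ⊗ a4.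
Proof.
apply: tens_hdual_ext => g.
rewrite !sw_sw; try by lin.
transitivity (hdual_comul (hdual_evl g a)).
  rewrite -hdual_comul_evr (lin_sw _ _ lin_hdual_comul); apply: eq_swd => a1 a2.
  by rewrite swd_pure ?(linZ lin_hdual_comul) //; lin.
transitivity (\sw_(a1, a2 <- hdual_comul a) a1 ⊗ hdual_evl g a2); last first.
  apply: eq_swd => a1 a2; rewrite -hdual_comul_evr pure_swr sw_sw; try by lin.
  apply: eq_swd => a3 a4; rewrite swd_pure; try by lin.
  by rewrite (linZ (lin_purer a1 (@lin_id _ _))).
apply: tens_hdual_ext => h; rewrite hdual_comul_evr sw_sw; try by lin.
transitivity (hdual_evl (h * g) a).
  by apply/lfunP => x; rewrite !hdual_evlE mulrA.
rewrite -hdual_comul_evr; apply: eq_swd => a1 a2.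
by rewrite swd_pure ?hdual_evlE //; lin.
Qed.

Lemma hdual_counitl a : \sw_(a1, a2 <- hdual_comul a) hdual_counit a1 *: a2 = a.
Proof. by rewrite hdual_comul_evl; apply/lfunP => x; rewrite hdual_evrE mul1r. Qed.

Lemma hdual_counitr a : \sw_(a1, a2 <- hdual_comul a) hdual_counit a2 *: a1 = a.
Proof. by rewrite hdual_comul_evr; apply/lfunP => x; rewrite hdual_evlE mulr1. Qed.

Lemma hdual_comul1 : hdual_comul (1 : hdual H) = 1 ⊗ 1.
Proof.
apply: tens_hdual2_ext => h g; rewrite hdual_comulE swd_pure; try by lin.
by rewrite !hdual1E counitM.
Qed.

Lemma hdual_comulM a b : hdual_comul (a * b) =
  \sw_(a1, a2 <- hdual_comul a) \sw_(b1, b2 <- hdual_comul b) (a1 * b1) ⊗ (a2 * b2).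
Proof.
apply: tens_hdual2_ext => h g; rewrite hdual_comulE sw_sw; last by lin.
under [RHS]eq_swd => a1 a2.
  rewrite sw_sw; last by lin.
  under eq_swd => b1 b2.
    rewrite swd_pure; [|by lin|by lin].
    rewrite !hdualME mulr_swl; under eq_swd => h1 h2 do rewrite mulr_swr.
    over.
  rewrite sw_exch; under eq_swd => h1 h2 do rewrite sw_exch.
  over.
rewrite sw_exch; under [RHS]eq_swd => h1 h2 do rewrite sw_exch.
rewrite hdualME comulMS; try by lin.
apply: eq_swd => h1 h2; apply: eq_swd => g1 g2.
rewrite -!hdual_comulE mulr_swl; apply: eq_swd => a1 a2.
rewrite mulr_swr; apply: eq_swd => b1 b2; exact: mulrACA.
Qed.

Lemma hdual_counit1 : hdual_counit (1 : hdual H) = 1.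
Proof. by rewrite /hdual_counit hdual1E counit1. Qed.

Lemma hdual_counitM a b : hdual_counit (a * b) = hdual_counit a * hdual_counit b.
Proof. by rewrite /hdual_counit hdualME comul1 swd_pure //; lin. Qed.

Lemma lin_hdual_counit : linear (@hdual_counit K H : hdual H -> K^o).
Proof. by rewrite /hdual_counit; lin. Qed.

Lemma lin_hdual_antipode : linear (@hdual_antipode K H).
Proof.
by move=> k a b; apply/lfunP => x; rewrite hdual_antipodeE !add_lfunE !scale_lfunE !hdual_antipodeE.
Qed.

Lemma hdual_antipodel a :
  \sw_(a1, a2 <- hdual_comul a) hdual_antipode a1 * a2 = hdual_counit a *: (1 : hdual H).
Proof.
apply/lfunP => h; rewrite sw_lfun scale_lfunE hdual1E.
under eq_swd => a1 a2 do rewrite hdualME.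
rewrite sw_exch; transitivity (a (counit h *: 1)).
  rewrite -antipodel lfun_sw; apply: eq_swd => h1 h2.
  rewrite -hdual_comulE; apply: eq_swd => a1 a2; by rewrite hdual_antipodeE.
by rewrite linearZ /= !scale_regE mulrC.
Qed.

Lemma hdual_antipoder a :
  \sw_(a1, a2 <- hdual_comul a) a1 * hdual_antipode a2 = hdual_counit a *: (1 : hdual H).
Proof.
apply/lfunP => h; rewrite sw_lfun scale_lfunE hdual1E.
under eq_swd => a1 a2 do rewrite hdualME.
rewrite sw_exch; transitivity (a (counit h *: 1)).
  rewrite -antipoder lfun_sw; apply: eq_swd => h1 h2.
  rewrite -hdual_comulE; apply: eq_swd => a1 a2; by rewrite hdual_antipodeE.
by rewrite linearZ /= !scale_regE mulrC.
Qed.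

HB.instance Definition _ := isHopf.Build K (hdual H)
  lin_hdual_comul lin_hdual_counit lin_hdual_antipode hdual_comulA hdual_counitl hdual_counitr hdual_comul1 hdual_comulM
  hdual_counit1 hdual_counitM hdual_antipodel hdual_antipoder.
End DualHopf.

Section AntipodeComul.
Variables (K : fieldType) (H : finHopfType K).

Lemma hdual_sep (x y : H) : (forall a : hdual H, a x = a y) -> x = y.
Proof.
move=> xy; rewrite (coord_vbasis (memvf x)) (coord_vbasis (memvf y)).
by apply: eq_bigr => i _; rewrite -!dual_basisE xy.
Qed.

Lemma antipode_comul (h : H) : comul (antipode h) =
  \sw_(h1, h2 <- comul h) antipode h2 ⊗ antipode h1.
Proof.
apply: tens_ext => c lc; apply: hdual_sep => a.
have [b bc] : exists b : hdual H, forall x, b x = c x.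
  by exists (linfun c) => x; rewrite linfunE.
have E (t : tens H H) : a (\sw_(x, y <- t) (c y : K) *: x) =
    \sw_(x, y <- t) (a x * b y : K^o).
  by rewrite lfun_sw; apply: eq_swd => x y; rewrite linearZ /= bc scale_regE mulrC.
rewrite !{}E sw_sw; last by lin.
rewrite -hdualME -hdual_antipodeE.
have -> : hdual_antipode (a * b) = hdual_antipode b * hdual_antipode a.
  exact: (antipodeM (H := hdual H) a b).
rewrite hdualME; apply: eq_swd => h1 h2.
rewrite !hdual_antipodeE swd_pure; [|by lin|by lin].
by rewrite mulrC.
Qed.

Lemma antipode_comulS (X : lmodType K) (F : H -> H -> X) (h : H) :
  (forall y, linear (fun x => F x y)) -> (forall y, linear (F y)) ->
  \sw_(x, y <- comul (antipode h)) F x y =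
  \sw_(h1, h2 <- comul h) F (antipode h2) (antipode h1).
Proof.
move=> l1 l2; rewrite antipode_comul sw_sw //; apply: eq_swd => u v.
by rewrite swd_pure.
Qed.
End AntipodeComul.

Definition counital_unit (K : fieldType) (A : finHopfType K) (a : A) : bool :=
  (a \is a GRing.unit) && (counit a == 1).
Definition Gcu (K : fieldType) (A : finHopfType K) : Type :=
  {a : A | counital_unit a}.

Section CounitalUnits.
Variables (K : fieldType) (A : finHopfType K).

HB.instance Definition _ := SubChoice.copy (Gcu A) {a : A | counital_unit a}.

Lemma counital_unit1 : counital_unit (1 : A).
Proof. by rewrite /counital_unit unitr1 counit1 eqxx. Qed.

Lemma counital_unitM (a b : A) :
  counital_unit a -> counital_unit b -> counital_unit (a * b).
Proof.
move=> /andP[ua /eqP ea] /andP[ub /eqP eb].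
by rewrite /counital_unit unitrMl // ua counitM ea eb mulr1 eqxx.
Qed.

Lemma counital_unitV (a : A) : counital_unit a -> counital_unit a^-1.
Proof.
move=> /andP[ua /eqP ea]; rewrite /counital_unit unitrV ua /=.
have := counitM a a^-1; rewrite mulrV // counit1 ea mul1r => <-; exact: eqxx.
Qed.

Definition Gcu_one : Gcu A := exist _ 1 counital_unit1.
Definition Gcu_mul (a b : Gcu A) : Gcu A :=
  exist _ (val a * val b) (counital_unitM (valP a) (valP b)).
Definition Gcu_inv (a : Gcu A) : Gcu A :=
  exist _ (val a)^-1 (counital_unitV (valP a)).

Lemma Gcu_mulA : associative Gcu_mul.
Proof. by move=> a b c; apply: val_inj; rewrite /= mulrA. Qed.
Lemma Gcu_mul1 : left_id Gcu_one Gcu_mul.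
Proof. by move=> a; apply: val_inj; rewrite /= mul1r. Qed.
Lemma Gcu_1mul : right_id Gcu_one Gcu_mul.
Proof. by move=> a; apply: val_inj; rewrite /= mulr1. Qed.
Lemma Gcu_mulV : left_inverse Gcu_one Gcu_inv Gcu_mul.
Proof. by move=> a; apply: val_inj; rewrite /= mulVr //; case/andP: (valP a). Qed.
Lemma Gcu_Vmul : right_inverse Gcu_one Gcu_inv Gcu_mul.
Proof. by move=> a; apply: val_inj; rewrite /= mulrV //; case/andP: (valP a). Qed.

HB.instance Definition _ := isGroup.Build (Gcu A)
  Gcu_mulA Gcu_mul1 Gcu_1mul Gcu_mulV Gcu_Vmul.
End CounitalUnits.

HB.mixin Record isDrinfeldYetter (K : fieldType) (H : finHopfType K) B
    of GRing.Lmodule K B := {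
  dy_act : B -> H -> B;
  dy_coact : B -> tens B H;
  dy_act_linl : forall h, linear (fun b => dy_act b h);
  dy_act_linr : forall b, linear (dy_act b);
  dy_act1 : forall b, dy_act b 1 = b;
  dy_actM : forall b g h, dy_act b (g * h) = dy_act (dy_act b g) h;
  dy_coact_lin : linear dy_coact;
  dy_coactA : forall b, \sw_(b0, b1 <- dy_coact b) dy_coact b0 ⊗ b1 =
    \sw_(b0, b1 <- dy_coact b) \sw_(b2, b3 <- comul b1) (b0 ⊗ b2) ⊗ b3;
  dy_coact_counit : forall b, \sw_(b0, b1 <- dy_coact b) counit b1 *: b0 = b;
  dy_compat : forall b h,
    \sw_(h1, h2 <- comul h) \sw_(b0, b1 <- dy_coact (dy_act b h2))
      b0 ⊗ (h1 * b1) =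
    \sw_(h1, h2 <- comul h) \sw_(b0, b1 <- dy_coact b) dy_act b0 h1 ⊗ (b1 * h2)
}.

#[short(type="dyModType")]
HB.structure Definition DrinfeldYetter (K : fieldType) (H : finHopfType K) :=
  { B of GRing.Lmodule K B & isDrinfeldYetter K H B }.

Reserved Notation "b ◁ h" (at level 40, left associativity).
Notation "b ◁ h" := (dy_act b h) : ring_scope.

HB.mixin Record DrinfeldYetter_isBraidedCommutative (K : fieldType)
    (H : finHopfType K) B of DrinfeldYetter K H B & GRing.Algebra K B := {
  dy_one_act : forall h : H, (1 : B) ◁ h = counit h *: 1;
  dy_mul_act : forall (a b : B) (h : H),
    (a * b) ◁ h = \sw_(h1, h2 <- comul h) (a ◁ h1) * (b ◁ h2);
  dy_coact1 : dy_coact (1 : B) = 1 ⊗ (1 : H);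
  dy_coactM : forall a b : B, dy_coact (a * b) =
    \sw_(a0, a1 <- dy_coact a) \sw_(b0, b1 <- dy_coact b)
      (a0 * b0) ⊗ (a1 * b1 : H);
  dy_braid_comm : forall a b : B,
    a * b = \sw_(b0, b1 <- dy_coact b) b0 * (a ◁ (b1 : H))
}.

#[short(type="bcAlgType")]
HB.structure Definition BraidedCommutative (K : fieldType) (H : finHopfType K) :=
  { B of DrinfeldYetter K H B & GRing.Algebra K B
       & DrinfeldYetter_isBraidedCommutative K H B }.

Ltac lin_step_ext ::= lazymatch goal with |- linear ?f => match f with
  | (fun x => @dy_act ?K ?H ?s ?b (@?g x)) =>
      refine (@lin_comp _ _ _ _ (@dy_act K H s b) g (@dy_act_linr K H s b) _)
  | (fun x => @dy_act ?K ?H ?s (@?g x) ?h) =>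
      refine (@lin_comp _ _ _ _ (fun b => @dy_act K H s b h) g (@dy_act_linl K H s h) _)
  | (fun x => @dy_coact ?K ?H ?s (@?g x)) =>
      refine (@lin_comp _ _ _ _ (@dy_coact K H s) g (@dy_coact_lin K H s) _)
  end end.

Section Cocycle.
Variables (K : fieldType) (H : finHopfType K) (B : bcAlgType H).

Definition psi (rho : H -> B) (b : B) : B :=
  \sw_(b0, b1 <- dy_coact b) b0 * rho b1.

Record is_cocycle (rho : H -> B) : Prop := IsCocycle {
  cocycle_lin : linear rho;
  cocycle_unital : rho 1 = 1;
  cocycle_mul : forall g h,
    rho (g * h) = \sw_(h1, h2 <- comul h) (rho g ◁ h1) * rho h2;
  cocycle_bij : bijective (psi rho) }.

Record Z1 : Type := MkZ1 { Z1_fun :> H -> B; Z1P : is_cocycle Z1_fun }.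

Definition bullet (r s : H -> B) (h : H) : B :=
  \sw_(h1, h2 <- comul h) r h1 * psi r (s h2).

Lemma coactAS (X : lmodType K) (F : B -> H -> H -> X) b :
  (forall y z, linear (fun x => F x y z)) ->
  (forall y z, linear (fun x => F y x z)) ->
  (forall y z, linear (fun x => F y z x)) ->
  \sw_(b0, b1 <- dy_coact b) \sw_(x, y <- dy_coact b0) F x y b1 =
  \sw_(b0, b1 <- dy_coact b) \sw_(x, y <- comul b1) F b0 x y.
Proof.
move=> l1 l2 l3.
pose Phi (t : tens (tens B H) H) := \sw_(s, z <- t) \sw_(x, y <- s) F x y z.
have lP : linear Phi by rewrite /Phi; lin.
have := congr1 Phi (dy_coactA (s := B) b).
rewrite (lin_sw _ _ lP).
have E1 x y : Phi (dy_coact x ⊗ y) = \sw_(u, v <- dy_coact x) F u v y.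
  by rewrite /Phi swd_pure //; lin.
under eq_swd => x y do rewrite E1.
move=> ->; rewrite (lin_sw _ _ lP); apply: eq_swd => x y.
rewrite (lin_sw _ _ lP); apply: eq_swd => u v.
rewrite /Phi swd_pure; try by lin.
rewrite swd_pure //; try by lin.
Qed.

Lemma coact_counitS (X : lmodType K) (f : B -> X) b : linear f ->
  \sw_(b0, b1 <- dy_coact b) (counit (b1 : H)) *: f b0 = f b.
Proof.
move=> lf; rewrite -[in RHS](dy_coact_counit (s := B) b) (lin_sw _ _ lf).
by apply: eq_swd => x y; rewrite linZ.
Qed.

Lemma coactMS (X : lmodType K) (F : B -> H -> X) a b :
  (forall y, linear (fun x => F x y)) -> (forall y, linear (F y)) ->
  \sw_(x, y <- dy_coact (a * b)) F x y =
  \sw_(a0, a1 <- dy_coact a) \sw_(b0, b1 <- dy_coact b) F (a0 * b0) (a1 * b1).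
Proof.
move=> l1 l2; rewrite dy_coactM sw_sw //; apply: eq_swd => x y.
by rewrite sw_sw //; apply: eq_swd => u v; rewrite swd_pure.
Qed.

Lemma dy_compatS (X : lmodType K) (F : B -> H -> X) (b : B) (h : H) :
  (forall y, linear (fun x => F x y)) -> (forall y, linear (F y)) ->
  \sw_(h1, h2 <- comul h) \sw_(b0, b1 <- dy_coact (dy_act b h2))
      F b0 (h1 * b1) =
  \sw_(h1, h2 <- comul h) \sw_(b0, b1 <- dy_coact b) F (dy_act b0 h1) (b1 * h2).
Proof.
move=> l1 l2.
pose Phi (t : tens B H) := \sw_(x, y <- t) F x y.
have lP : linear Phi by rewrite /Phi; lin.
have := congr1 Phi (dy_compat (s := B) b h).
rewrite !(lin_sw _ _ lP).
under eq_swd => x y do rewrite (lin_sw _ _ lP).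
under [RHS]eq_swd => x y do rewrite (lin_sw _ _ lP).
have E x y : Phi (x ⊗ y) = F x y by rewrite /Phi swd_pure.
under eq_swd => x y do under eq_swd => u v do rewrite E.
by under [RHS]eq_swd => x y do under eq_swd => u v do rewrite E.
Qed.

Lemma psi_lin r : linear r -> linear (psi r).
Proof. by move=> lr; rewrite /psi; lin. Qed.

Section OneCocycle.
Variable (r : H -> B).
Hypothesis (lr : linear r) (r1 : r 1 = 1).
Hypothesis rM : forall g h,
  r (g * h) = \sw_(h1, h2 <- comul h) (r g ◁ h1) * r h2.

Let lpr : linear (psi r) := psi_lin lr.

Lemma psi1 : psi r 1 = 1.
Proof. by rewrite /psi dy_coact1 swd_pure ?r1 ?mulr1 //; lin. Qed.

Lemma psiM a b : psi r (a * b) = psi r a * psi r b.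
Proof.
rewrite /psi coactMS; try by lin.
rewrite mulr_swl; apply: eq_swd => a0 a1.
under eq_swd => b0 b1 do rewrite rM mulr_swr.
rewrite -(coactAS (F := fun b0 h1 h2 => a0 * b0 * ((r a1 ◁ h1) * r h2)));
  try by lin.
rewrite mulr_swr; apply: eq_swd => b0 b1.
rewrite [RHS]mulrA -[a0 * r a1 * b0]mulrA [r a1 * b0]dy_braid_comm mulr_swr mulr_swl.
by apply: eq_swd => b2 b3; rewrite !mulrA.
Qed.

Lemma psi_act b h : \sw_(h1, h2 <- comul h) r h1 * psi r (b ◁ h2) =
  \sw_(h1, h2 <- comul h) (psi r b ◁ h1) * r h2.
Proof.
transitivity (\sw_(h1, h2 <- comul h) \sw_(b0, b1 <- dy_coact (b ◁ h2))
    b0 * r (h1 * b1)).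
  apply: eq_swd => h1 h2; rewrite /psi mulr_swr.
  under [RHS]eq_swd => b0 b1 do rewrite rM mulr_swr.
  rewrite -(coactAS (F := fun b0 x y => b0 * ((r h1 ◁ x) * r y))); try by lin.
  apply: eq_swd => b0 b1; rewrite [LHS]mulrA [r h1 * b0]dy_braid_comm mulr_swl.
  by apply: eq_swd => b2 b3; rewrite mulrA.
rewrite (dy_compatS (F := fun b0 h => b0 * r h)); try by lin.
under eq_swd => h1 h2 do under eq_swd => b0 b1 do rewrite rM mulr_swr.
under eq_swd => h1 h2 do rewrite sw_exch.
rewrite -(coassocS (F := fun h1 h2 h3 => \sw_(b0, b1 <- dy_coact b)
  (b0 ◁ h1) * ((r b1 ◁ h2) * r h3))); try by lin.
apply: eq_swd => h1 h2.
rewrite /psi (lin_sw _ _ (g := fun x => (x ◁ h1) * r h2)); last by lin.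
rewrite sw_exch; apply: eq_swd => b0 b1.
rewrite dy_mul_act mulr_swl.
by apply: eq_swd => h3 h4; rewrite mulrA.
Qed.

Lemma bullet_mul (s : H -> B) : linear s ->
  (forall g h, s (g * h) = \sw_(h1, h2 <- comul h) (s g ◁ h1) * s h2) ->
  forall g h,
  bullet r s (g * h) = \sw_(h1, h2 <- comul h) (bullet r s g ◁ h1) * bullet r s h2.
Proof.
move=> ls sM g h; rewrite /bullet comulMS; try by lin.
transitivity (\sw_(g1, g2 <- comul g) \sw_(x, h2 <- comul h)
  \sw_(k, w <- comul h2) \sw_(y, z <- comul k)
    (r g1 ◁ x) * ((psi r (s g2) ◁ y) * r z) * psi r (s w)).
  apply: eq_swd => g1 g2.
  transitivity (\sw_(h1, h2 <- comul h) \sw_(x, y <- comul h1)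
    \sw_(z, w <- comul h2)
       (r g1 ◁ x) * (r y * psi r (s g2 ◁ z)) * psi r (s w)).
    apply: eq_swd => h1 h2; rewrite rM mulr_swl; apply: eq_swd => x y.
    rewrite sM (lin_sw _ _ lpr) mulr_swr; apply: eq_swd => z w.
    by rewrite psiM !mulrA.
  rewrite coassocS4; try by lin.
  apply: eq_swd => x h2; apply: eq_swd => k w.
  by rewrite -!mulr_swl -!mulr_swr psi_act.
rewrite sw_exch [RHS](_ : _ = \sw_(h1, h2 <- comul h) \sw_(x, y <- comul h1)
  \sw_(z, w <- comul h2) \sw_(g1, g2 <- comul g)
     (r g1 ◁ x) * ((psi r (s g2) ◁ y) * r z) * psi r (s w)).
  rewrite coassocS4; try by lin.
  apply: eq_swd => x h2; rewrite sw_exch; apply: eq_swd => k w.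
  by rewrite sw_exch.
apply: eq_swd => h1 h2.
rewrite (lin_sw _ _ (g := fun x => x ◁ h1)); last by lin.
rewrite mulr_swl; under [RHS]eq_swd => x y do rewrite sw_exch.
rewrite [RHS]sw_exch; apply: eq_swd => g1 g2.
rewrite dy_mul_act mulr_swl; apply: eq_swd => x y.
by rewrite mulr_swr; apply: eq_swd => z w; rewrite !mulrA.
Qed.

Lemma psi_bullet (s : H -> B) : linear s -> psi (bullet r s) =1 psi r \o psi s.
Proof.
move=> ls b; rewrite /= [LHS]/psi /bullet.
under eq_swd => b0 b1 do rewrite /= mulr_swr.
rewrite -(coactAS (F := fun b0 x y => b0 * (r x * psi r (s y)))); try by lin.
transitivity (psi r (\sw_(b0, b1 <- dy_coact b) b0 * s b1)); last by [].
rewrite (lin_sw _ _ lpr); apply: eq_swd => b0 b1.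
rewrite psiM [X in _ = X * _]/psi mulr_swl; apply: eq_swd => x y.
by rewrite mulrA.
Qed.

Lemma bulletA (s t : H -> B) : linear s -> linear t ->
  bullet (bullet r s) t =1 bullet r (bullet s t).
Proof.
move=> ls lt h; have lps := psi_lin ls.
transitivity (\sw_(h1, h2 <- comul h) \sw_(x, y <- comul h1)
    r x * psi r (s y) * psi r (psi s (t h2))).
  by apply: eq_swd => h1 h2; rewrite psi_bullet // mulr_swl.
rewrite (coassocS (F := fun x y z => r x * psi r (s y) * psi r (psi s (t z))));
  try by lin.
apply: eq_swd => x k; rewrite (lin_sw _ _ lpr) mulr_swr.
by apply: eq_swd => y z; rewrite psiM mulrA.
Qed.

(* [rinv] is the convolution inverse of r; the inverse of r in Z^1 is
   psi^-1 \o rinv. *)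
Definition rinv (h : H) : B :=
  \sw_(h1, h2 <- comul h) r (antipode h1) ◁ h2.

Lemma rinv_lin : linear rinv. Proof. by rewrite /rinv; lin. Qed.
Let lri := rinv_lin.

Lemma act_one_counit (h : H) : (1 : B) ◁ h = counit h *: 1.
Proof. exact: dy_one_act. Qed.

Lemma rinvl h : \sw_(h1, h2 <- comul h) rinv h1 * r h2 = counit h *: (1 : B).
Proof.
transitivity (r (counit h *: 1)); last by rewrite (linZ lr) r1.
rewrite -antipodel (lin_sw _ _ lr).
under [RHS]eq_swd => h1 h2 do rewrite rM.
rewrite -(coassocS (F := fun h1 x y => (r (antipode h1) ◁ x) * r y)); try by lin.
by apply: eq_swd => h1 h2; rewrite mulr_swl.
Qed.

Lemma rinvr h : \sw_(h1, h2 <- comul h) r h1 * rinv h2 = counit h *: (1 : B).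
Proof.
transitivity (\sw_(k, h3 <- comul h) (r (counit k *: 1) ◁ h3)); last first.
  under eq_swd => k h3 do
    rewrite (linZ lr) r1 (linZ (dy_act_linl h3)) act_one_counit scalerA.
  rewrite -(counitlS (f := fun k => counit k *: (1 : B))); last by lin.
  by apply: eq_swd => x y; rewrite scalerA.
transitivity (\sw_(k, h3 <- comul h) \sw_(h1, h2 <- comul k)
    (r (h1 * antipode h2) ◁ h3)); last first.
  apply: eq_swd => k h3; rewrite -antipoder.
  by rewrite (lin_sw _ _ (g := fun x => r x ◁ h3)) //; lin.
rewrite (coassocS (F := fun h1 h2 h3 => r (h1 * antipode h2) ◁ h3)); try by lin.
apply: eq_swd => h1 m; rewrite mulr_swr.
transitivity (\sw_(u, n <- comul m) \sw_(k, q <- comul n) \sw_(v, p <- comul k)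
    (r h1 ◁ (antipode v * p)) * (r (antipode u) ◁ q)).
  apply: eq_swd => u n.
  rewrite -(counitlS (f := fun q => r h1 * (r (antipode u) ◁ q))); last by lin.
  apply: eq_swd => k q.
  rewrite -mulr_swl -(lin_sw _ _ (dy_act_linr (r h1))) antipodel.
  by rewrite (linZ (dy_act_linr _)) dy_act1 scalerAl.
rewrite -(coassocS4 (F := fun u v p q =>
  (r h1 ◁ (antipode v * p)) * (r (antipode u) ◁ q))); try by lin.
apply: eq_swd => h2 h3; rewrite rM.
rewrite antipode_comulS; try by lin.
rewrite (lin_sw _ _ (dy_act_linl h3)); apply: eq_swd => u v.
by rewrite dy_mul_act; apply: eq_swd => p q; rewrite !dy_actM.
Qed.

Lemma rinvM g h : rinv (g * h) = \sw_(h1, h2 <- comul h) rinv h1 * (rinv g ◁ h2).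
Proof.
apply: (@conv_inv_uniq K H B (fun g h => rinv (g * h)) (fun g h => r (g * h))
  (fun g h => \sw_(h1, h2 <- comul h) rinv h1 * (rinv g ◁ h2)))
  => [||||||{}g {}h|{}g {}h]; try by lin.
- transitivity (\sw_(x, y <- comul (g * h)) rinv x * r y).
    by rewrite comulMS //; lin.
  by rewrite rinvl counitM scalerA.
transitivity (\sw_(g1, g2 <- comul g) (r g1 * rinv g2) ◁ h); last first.
  rewrite -(lin_sw _ _ (dy_act_linl h)) rinvr (linZ (dy_act_linl h)).
  by rewrite act_one_counit.
apply: eq_swd => g1 g2; rewrite dy_mul_act.
under eq_swd => h1 h2 do rewrite rM mulr_swl.
under eq_swd => h1 h2 do under eq_swd => p q do rewrite mulr_swr.
rewrite (coassocS4 (F := fun p q x y =>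
  (r g1 ◁ p) * r q * (rinv x * (rinv g2 ◁ y)))); try by lin.
apply: eq_swd => p n.
rewrite -(counitlS (f := fun n => (r g1 ◁ p) * (rinv g2 ◁ n))); last by lin.
apply: eq_swd => k y.
under eq_swd => q x do rewrite mulrA -[_ * r q * _]mulrA.
rewrite -mulr_swl -mulr_swr rinvr.
by rewrite -scalerAr mulr1 scalerAl.
Qed.

Lemma psi_act_rinv b h : psi r (b ◁ h) =
  \sw_(h1, m <- comul h) \sw_(x, y <- comul m) rinv h1 * (psi r b ◁ x) * r y.
Proof.
transitivity (\sw_(h1, m <- comul h) \sw_(x, y <- comul m)
   rinv h1 * r x * psi r (b ◁ y)).
  rewrite -(coassocS (F := fun h1 x y => rinv h1 * r x * psi r (b ◁ y))); try by lin.
  rewrite -[LHS](counitlS (f := fun h => psi r (b ◁ h))); last by lin.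
  by apply: eq_swd => k y; rewrite -mulr_swl rinvl -scalerAl mul1r.
apply: eq_swd => h1 m.
under eq_swd => x y do rewrite -mulrA.
by under [RHS]eq_swd => x y do rewrite -mulrA; rewrite -!mulr_swr psi_act.
Qed.

Lemma psi_rinv b : \sw_(b0, b1 <- dy_coact b) psi r b0 * rinv b1 = b.
Proof.
under eq_swd => b0 b1 do rewrite mulr_swl.
rewrite (coactAS (F := fun b0 x y => b0 * r x * rinv y)); try by lin.
rewrite -[RHS](dy_coact_counit (s := B)); apply: eq_swd => b0 b1.
under eq_swd => x y do rewrite -mulrA.
by rewrite -mulr_swr rinvr -scalerAr mulr1.
Qed.
End OneCocycle.

Lemma cocycle_inverse (r : H -> B) : is_cocycle r ->
  exists s : H -> B, is_cocycle s /\ bullet r s =1 (fun h => counit h *: 1).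
Proof.
move=> [lr r1 rM [phi psiK phiK]].
have lpr := psi_lin lr; have lri := rinv_lin lr.
have lphi : linear phi.
  by move=> a u v; apply: (can_inj psiK); rewrite lpr !phiK.
pose s h := phi (rinv r h).
have psis h : psi r (s h) = rinv r h by rewrite /s phiK.
have ls : linear s by rewrite /s; lin.
have Es : psi s =1 phi.
  move=> b; apply: (can_inj psiK); rewrite phiK -[RHS](psi_rinv lr r1 rM).
  rewrite /(psi s) (lin_sw _ _ lpr); apply: eq_swd => b0 b1.
  by rewrite (psiM lr rM) psis.
exists s; split; last first.
  move=> h; rewrite -(rinvr lr r1 rM); apply: eq_swd => x y.
  by rewrite psis.
split=> //.
- apply: (can_inj psiK); rewrite psis (psi1 lr r1) /rinv comul1.
  by rewrite swd_pure ?antipode1 ?r1 ?dy_act1 //; lin.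
- move=> g h; apply: (can_inj psiK); rewrite psis (rinvM lr r1 rM).
  rewrite (lin_sw _ _ lpr).
  have Q h1 h2 : psi r ((s g ◁ h1) * s h2) =
      \sw_(m, y <- comul h1) \sw_(a, x <- comul m)
        rinv r a * (rinv r g ◁ x) * r y * rinv r h2.
    rewrite (psiM lr rM) psis (psi_act_rinv lr r1 rM) psis.
    rewrite -(coassocS (F := fun a x y => rinv r a * (rinv r g ◁ x) * r y)); try by lin.
    by rewrite mulr_swl; apply: eq_swd => m y; rewrite mulr_swl.
  under [RHS]eq_swd => h1 h2 do rewrite Q.
  rewrite [RHS](coassocS (F := fun m y h2 => \sw_(a, x <- comul m)
    rinv r a * (rinv r g ◁ x) * r y * rinv r h2)); try by lin.
  rewrite -[LHS](counitrS (f := fun h => \sw_(a, x <- comul h)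
    rinv r a * (rinv r g ◁ x))); last by lin.
  apply: eq_swd => m n; rewrite sw_exch scaler_sw; apply: eq_swd => a x.
  under [RHS]eq_swd => y z do rewrite -mulrA.
  by rewrite -mulr_swr (rinvr lr r1 rM) -scalerAr mulr1.
- by exists (psi r) => b; rewrite Es ?phiK ?psiK.
Qed.

Lemma cocycle_one : is_cocycle (fun h : H => counit h *: (1 : B)).
Proof.
have psiE : psi (fun h : H => counit h *: (1 : B)) =1 id.
  move=> b; rewrite /psi -[RHS](dy_coact_counit (s := B)).
  by apply: eq_swd => b0 b1; rewrite -scalerAr mulr1.
split; first by lin.
- by rewrite counit1 scale1r.
- move=> g h; rewrite counitM -scalerA.
  rewrite -(counitrS (f := fun x => counit g *: (counit x *: (1 : B)))); last by lin.
  apply: eq_swd => h1 h2.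
  by rewrite (linZ (dy_act_linl h1)) dy_one_act -scalerAr mulr1.
- by exists id => b; rewrite psiE.
Qed.

Lemma cocycle_bullet (r s : H -> B) :
  is_cocycle r -> is_cocycle s -> is_cocycle (bullet r s).
Proof.
move=> [lr r1 rM br] [ls s1 sM bs]; have lpr := psi_lin lr; split.
- by rewrite /bullet; lin.
- rewrite /bullet comul1 swd_pure; try by lin.
  by rewrite r1 s1 (psi1 lr r1) mulr1.
- exact: bullet_mul.
- apply: (eq_bij (bij_comp br bs)) => b.
  by rewrite (psi_bullet lr rM ls).
Qed.

Definition Z1_one : Z1 := MkZ1 cocycle_one.
Definition Z1_mul (r s : Z1) : Z1 := MkZ1 (cocycle_bullet (Z1P r) (Z1P s)).

Lemma Z1_ext (r s : Z1) : r =1 s -> r = s.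
Proof.
case: r s => [r rP] [s sP] /= /funext rs; subst s.
by rewrite (Prop_irrelevance rP sP).
Qed.

Lemma Z1_right_inverse (r : Z1) : exists s : Z1, Z1_mul r s = Z1_one.
Proof.
have [s [sP rs]] := cocycle_inverse (Z1P r).
by exists (MkZ1 sP); apply: Z1_ext.
Qed.
Definition Z1_inv (r : Z1) : Z1 := sval (cid (Z1_right_inverse r)).

Lemma Z1_mulA : associative Z1_mul.
Proof.
move=> [r [lr r1 rM br]] [s [ls s1 sM bs]] [t [lt t1 tM bt]].
by apply: Z1_ext => h /=; rewrite bulletA.
Qed.

Lemma Z1_mul1 : left_id Z1_one Z1_mul.
Proof.
move=> [s [ls s1 sM bs]]; apply: Z1_ext => h /=.
rewrite -[RHS](counitlS (f := s)) //; apply: eq_swd => x y.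
rewrite -scalerAl mul1r; congr (_ *: _).
rewrite /psi -[RHS](dy_coact_counit (s := B)).
by apply: eq_swd => b0 b1; rewrite -scalerAr mulr1.
Qed.

Lemma Z1_1mul : right_id Z1_one Z1_mul.
Proof.
move=> [r [lr r1 rM br]]; apply: Z1_ext => h /=.
rewrite -[RHS](counitrS (f := r)) //; apply: eq_swd => x y.
by rewrite (linZ (psi_lin lr)) (psi1 lr r1) -scalerAr mulr1.
Qed.

Lemma Z1_mulV : right_inverse Z1_one Z1_inv Z1_mul.
Proof. by move=> r; rewrite /Z1_inv; case: cid. Qed.

Lemma Z1_Vmul : left_inverse Z1_one Z1_inv Z1_mul.
Proof.
move=> r; rewrite -[LHS]Z1_1mul -[in LHS](Z1_mulV (Z1_inv r)) Z1_mulA.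
by rewrite -[X in Z1_mul X _]Z1_mulA Z1_mulV Z1_1mul Z1_mulV.
Qed.

HB.instance Definition _ := gen_eqMixin Z1.
HB.instance Definition _ := gen_choiceMixin Z1.
HB.instance Definition _ := isGroup.Build Z1
  Z1_mulA Z1_mul1 Z1_1mul Z1_Vmul Z1_mulV.
End Cocycle.

Section DualBC.
Variables (K : fieldType) (H : finHopfType K).
Implicit Types (g h : H) (a b c : hdual H).

(* a ◁ h = < a_(1), h > a_(2) *)
Definition hdual_act a h : hdual H := \sw_(a1, a2 <- comul a) (a1 h : K) *: a2.

Definition hdual_adj a b : hdual H := \sw_(b1, b2 <- comul b) b1 * a * antipode b2.

(* The coaction determined by [hdual_coactE]: with e_i the basis of H and e^i
   the dual basis, Δ_R a = \sum_i (e^i_(1) a S(e^i_(2))) ⊗ e_i. *)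
Definition hdual_coact a : tens (hdual H) H :=
  \sum_(i < \dim {:H}) hdual_adj a (dual_basis i) ⊗ (vbasis {:H})`_i.

Lemma hdual_actE a h x : hdual_act a h x = a (h * x).
Proof. by rewrite /hdual_act [comul _]/(hdual_comul _) hdual_comul_evl hdual_evrE. Qed.

Lemma hdual_adj_linr a : linear (hdual_adj a).
Proof. by rewrite /hdual_adj; lin. Qed.
Lemma hdual_adj_linl b : linear (fun a => hdual_adj a b).
Proof. by rewrite /hdual_adj; lin. Qed.

(* (id (x) b)(Δ_R a) = b_(1) a S(b_(2)) *)
Lemma hdual_coactE a b :
  \sw_(a0, a1 <- hdual_coact a) (b a1 : K) *: a0 =
  \sw_(b1, b2 <- comul b) b1 * a * antipode b2.
Proof.
rewrite -/(hdual_adj a b).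
have lT : linear (fun t : tens (hdual H) H => \sw_(x, y <- t) (b y : K) *: x) by lin.
rewrite /hdual_coact (lin_sum lT) [in RHS](hdual_decomp b).
rewrite (lin_sum (hdual_adj_linr a)); apply: eq_bigr => i _.
by rewrite swd_pure ?(linZ (hdual_adj_linr a)) //; lin.
Qed.

Lemma tens_dual_ext (V : lmodType K) (s t : tens V H) :
  (forall c, \sw_(x, y <- s) (c y : K) *: x = \sw_(x, y <- t) (c y : K) *: x) ->
  s = t.
Proof.
move=> st; apply: tens_ext => c lc.
have E (r : tens V H) : \sw_(x, y <- r) (c y : K) *: x =
    \sw_(x, y <- r) ((linfun c : hdual H) y : K) *: x.
  by apply: eq_swd => x y; rewrite linfunE.
by rewrite !E st.
Qed.

Lemma hdual_act_linl h : linear (fun a => hdual_act a h).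
Proof. by rewrite /hdual_act; lin. Qed.
Lemma hdual_act_linr a : linear (hdual_act a).
Proof. by rewrite /hdual_act; lin. Qed.

Lemma hdual_act1 a : hdual_act a 1 = a.
Proof. by apply/lfunP => x; rewrite hdual_actE mul1r. Qed.
Lemma hdual_actM a g h : hdual_act a (g * h) = hdual_act (hdual_act a g) h.
Proof. by apply/lfunP => x; rewrite !hdual_actE mulrA. Qed.

Lemma hdual_coact_lin : linear hdual_coact.
Proof.
move=> k a b; rewrite /hdual_coact scaler_sumr -big_split; apply: eq_bigr => i _.
by rewrite hdual_adj_linl; apply: (lin_purel (g := fun z => z) _ (@lin_id _ _)).
Qed.

Lemma hdual_coact_ev a b :
  \sw_(a0, a1 <- hdual_coact a) (b a1 : K) *: a0 = hdual_adj a b.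
Proof. exact: hdual_coactE. Qed.

Lemma hdual_adjM a b c : hdual_adj a (b * c) = hdual_adj (hdual_adj a c) b.
Proof.
rewrite /hdual_adj comulMS; try by lin.
apply: eq_swd => b1 b2; rewrite mulr_swr mulr_swl; apply: eq_swd => c1 c2.
by rewrite antipodeM !mulrA.
Qed.

Lemma hdual_adj_one a : hdual_adj a 1 = a.
Proof.
by rewrite /hdual_adj comul1 swd_pure ?antipode1 ?mulr1 ?mul1r //; lin.
Qed.

Lemma hdual_coactA a : \sw_(a0, a1 <- hdual_coact a) hdual_coact a0 ⊗ a1 =
  \sw_(a0, a1 <- hdual_coact a) \sw_(a2, a3 <- comul a1) (a0 ⊗ a2) ⊗ a3.
Proof.
apply: tens_dual_ext => c; rewrite !sw_sw; try by lin.
transitivity (hdual_coact (hdual_adj a c)).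
  rewrite -hdual_coact_ev (lin_sw _ _ hdual_coact_lin); apply: eq_swd => x y.
  by rewrite swd_pure ?(linZ hdual_coact_lin) //; lin.
apply: tens_dual_ext => b; rewrite hdual_coact_ev -hdual_adjM -hdual_coact_ev.
rewrite sw_sw; last by lin.
apply: eq_swd => x y; rewrite hdualME !sw_sw; try by lin.
rewrite (lin_sw _ _ (g := fun z : K^o => (z : K) *: x)); last by lin.
apply: eq_swd => u v; rewrite swd_pure; try by lin.
have -> : (c v : K) *: (x ⊗ u) = ((c v : K) *: x) ⊗ u.
  by rewrite -(linZ (lin_purel (g := fun z => z) u (@lin_id _ _))).
by rewrite swd_pure ?scalerA //; lin.
Qed.

Lemma hdual_coact_counit a : \sw_(a0, a1 <- hdual_coact a) counit a1 *: a0 = a.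
Proof.
rewrite -[RHS]hdual_adj_one -hdual_coact_ev; apply: eq_swd => x y.
by rewrite hdual1E.
Qed.

Lemma hdual_mul_act a b h :
  hdual_act (a * b) h = \sw_(h1, h2 <- comul h) hdual_act a h1 * hdual_act b h2.
Proof.
apply/lfunP => x; rewrite hdual_actE hdualME comulMS ?sw_lfun; try by lin.
apply: eq_swd => h1 h2; rewrite hdualME; apply: eq_swd => x1 x2.
by rewrite !hdual_actE.
Qed.

Lemma hdual_one_act h : hdual_act 1 h = counit h *: 1.
Proof.
by apply/lfunP => x; rewrite hdual_actE scale_lfunE !hdual1E counitM.
Qed.

Lemma comul_dual_act c h :
  comul (hdual_act c h) = \sw_(c1, c2 <- comul c) hdual_act c1 h ⊗ c2.
Proof.
apply: tens_hdual2_ext => x y; rewrite hdual_comulE hdual_actE mulrA -hdual_comulE sw_sw;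
  last by lin.
apply: eq_swd => c1 c2; rewrite swd_pure ?hdual_actE //; lin.
Qed.

Lemma comul_dtl c g : comul (hdual_evl g c) = \sw_(c1, c2 <- comul c) c1 ⊗ hdual_evl g c2.
Proof.
apply: tens_hdual2_ext => x y; rewrite hdual_comulE hdual_evlE -mulrA -hdual_comulE sw_sw;
  last by lin.
apply: eq_swd => c1 c2; rewrite swd_pure ?hdual_evlE //; lin.
Qed.

Lemma hdual_compat a h :
  \sw_(h1, h2 <- comul h) \sw_(b0, b1 <- hdual_coact (hdual_act a h2))
    b0 ⊗ (h1 * b1) =
  \sw_(h1, h2 <- comul h) \sw_(b0, b1 <- hdual_coact a) hdual_act b0 h1 ⊗ (b1 * h2).
Proof.
have lal := hdual_act_linl; have lar := hdual_act_linr.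
apply: tens_dual_ext => c; rewrite !sw_sw; try by lin.
transitivity (\sw_(c1, c2 <- comul c) hdual_act (c1 * a) h * antipode c2).
  transitivity (\sw_(h1, h2 <- comul h) hdual_adj (hdual_act a h2) (hdual_act c h1)).
    apply: eq_swd => h1 h2; rewrite -hdual_coact_ev sw_sw; last by lin.
    apply: eq_swd => x y; rewrite swd_pure ?hdual_actE //; lin.
  under [RHS]eq_swd => c1 c2 do rewrite hdual_mul_act mulr_swl.
  rewrite [RHS]sw_exch; apply: eq_swd => h1 h2.
  rewrite /hdual_adj comul_dual_act sw_sw; last by lin.
  by apply: eq_swd => c1 c2; rewrite swd_pure //; lin.
transitivity (\sw_(h1, h2 <- comul h) hdual_act (hdual_adj a (hdual_evl h2 c)) h1); last first.
  apply: eq_swd => h1 h2; rewrite -hdual_coact_ev (lin_sw _ _ (lal h1)) sw_sw;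
    last by lin.
  by apply: eq_swd => x y; rewrite swd_pure ?hdual_evlE ?(linZ (lal _)) //; lin.
have ldtl d : linear (fun g => @hdual_evl K H g d).
  move=> k x y; apply/lfunP => z.
  by rewrite add_lfunE scale_lfunE !hdual_evlE mulrDr -scalerAr linearP.
have ldtr g : linear (fun d => @hdual_evl K H g d) by exact: lin_hdual_evl.
transitivity (\sw_(c1, c2 <- comul c) \sw_(x, k <- comul h) \sw_(y, z <- comul k)
    hdual_act (c1 * a) x * hdual_act (antipode (hdual_evl z c2)) y); last first.
  rewrite sw_exch [RHS](_ : _ = \sw_(h1, h2 <- comul h) \sw_(x, y <- comul h1)
    \sw_(c1, c2 <- comul c) hdual_act (c1 * a) x * hdual_act (antipode (hdual_evl h2 c2)) y).
    rewrite [RHS](coassocS (F := fun x y h2 => \sw_(c1, c2 <- comul c)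
      hdual_act (c1 * a) x * hdual_act (antipode (hdual_evl h2 c2)) y)); try by lin.
    by apply: eq_swd => x k; rewrite sw_exch.
  apply: eq_swd => h1 h2; rewrite /hdual_adj comul_dtl sw_sw; last by lin.
  rewrite (lin_sw _ _ (lal h1)) sw_exch; apply: eq_swd => c1 c2.
  by rewrite swd_pure ?hdual_mul_act //; lin.
apply: eq_swd => c1 c2.
rewrite -[LHS](counitrS (f := fun h => hdual_act (c1 * a) h * antipode c2)); last by lin.
apply: eq_swd => x k; rewrite -mulr_swr scalerAr; congr (_ * _).
apply/lfunP => u; rewrite sw_lfun scale_lfunE.
transitivity (c2 (antipode u * (counit k *: 1))).
  by rewrite -scalerAr mulr1 linearZ [antipode c2]/(hdual_antipode c2) hdual_antipodeE.
rewrite -antipodel mulr_swr lfun_sw; apply: eq_swd => y z.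
rewrite hdual_actE [antipode (hdual_evl z c2)]/(hdual_antipode _) hdual_antipodeE hdual_evlE antipodeM.
by rewrite mulrA.
Qed.

Lemma hdual_coact1 : hdual_coact 1 = 1 ⊗ 1.
Proof.
apply: tens_dual_ext => c; rewrite hdual_coact_ev swd_pure; try by lin.
rewrite /hdual_adj; under eq_swd => x y do rewrite mulr1.
exact: antipoder.
Qed.

Lemma hdual_adj_mul a b c :
  hdual_adj (a * b) c = \sw_(c1, c2 <- comul c) hdual_adj a c1 * hdual_adj b c2.
Proof.
transitivity (\sw_(c1, c2 <- comul c) \sw_(x, y <- comul c1) \sw_(z, w <- comul c2)
   x * a * (antipode y * z) * (b * antipode w)); last first.
  apply: eq_swd => c1 c2; rewrite mulr_swl; apply: eq_swd => x y.
  by rewrite mulr_swr; apply: eq_swd => z w; rewrite !mulrA.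
rewrite (coassocS4 (F := fun x y z w => x * a * (antipode y * z) * (b * antipode w)));
  try by lin.
apply: eq_swd => x n.
rewrite -[LHS](counitlS (f := fun n => x * (a * b) * antipode n)); last by lin.
apply: eq_swd => k w; rewrite -mulr_swl -mulr_swr antipodel.
by rewrite -scalerAr mulr1 -scalerAl !mulrA.
Qed.

Lemma hdual_coactM a b : hdual_coact (a * b) =
  \sw_(a0, a1 <- hdual_coact a) \sw_(b0, b1 <- hdual_coact b) (a0 * b0) ⊗ (a1 * b1).
Proof.
apply: tens_dual_ext => c; rewrite hdual_coact_ev hdual_adj_mul sw_sw; last by lin.
under eq_swd => c1 c2 do rewrite -!hdual_coact_ev mulr_swl.
rewrite sw_exch; apply: eq_swd => a0 a1.
rewrite sw_sw; last by lin.
under eq_swd => c1 c2 do rewrite mulr_swr.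
rewrite sw_exch; apply: eq_swd => b0 b1; rewrite swd_pure; try by lin.
rewrite -hdual_comulE (lin_sw _ _ (g := fun z : K^o => (z : K) *: (a0 * b0))); last by lin.
by apply: eq_swd => c1 c2; rewrite -scalerAl -scalerAr scalerA.
Qed.

Lemma hdual_braid_comm a b :
  a * b = \sw_(b0, b1 <- hdual_coact b) b0 * hdual_act a b1.
Proof.
transitivity (\sw_(a1, a2 <- comul a) hdual_adj b a1 * a2); last first.
  under eq_swd => a1 a2 do rewrite -hdual_coact_ev mulr_swl.
  rewrite sw_exch; apply: eq_swd => b0 b1; rewrite mulr_swr.
  by apply: eq_swd => a1 a2; rewrite -scalerAl scalerAr.
under [RHS]eq_swd => a1 a2 do rewrite mulr_swl.
rewrite (coassocS (F := fun x y z => x * b * antipode y * z)); try by lin.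
rewrite -[LHS](counitrS (f := fun a => a * b)); last by lin.
apply: eq_swd => x n; under [RHS]eq_swd => y z do rewrite -mulrA.
by rewrite -mulr_swr antipodel -scalerAr mulr1.
Qed.

HB.instance Definition _ := isDrinfeldYetter.Build K H (hdual H)
  hdual_act_linl hdual_act_linr hdual_act1 hdual_actM hdual_coact_lin hdual_coactA
  hdual_coact_counit hdual_compat.
HB.instance Definition _ := DrinfeldYetter_isBraidedCommutative.Build K H (hdual H)
  hdual_one_act hdual_mul_act hdual_coact1 hdual_coactM hdual_braid_comm.
End DualBC.

(* Main.v *)
Require Import Defs.
From HB Require Import structures.
From mathcomp Require Import all_boot all_order all_algebra all_field.

Set Implicit Arguments.
Unset Strict Implicit.
Unset Printing Implicit Defensive.

Import GRing.Theory.
Local Open Scope ring_scope.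

(** In any braided-commutative algebra B, an invertible element a gives the
    1-cocycle h |-> (a ◁ h) a^-1: the cocycle identity is the telescoping
    ((a ◁ g) a^-1) ◁ h_(1) (a ◁ h_(2)) a^-1 = (a ◁ gh) a^-1, which holds because
    the action is by module-algebra maps, and the associated map psi is
    conjugation by a because braided commutativity says precisely
    b_(0) (a ◁ b_(1)) = a b.  Multiplicativity in a is again a telescoping.

    For B = H^* every cocycle arises in this way, from exactly one counital
    unit, because the counit of H^*, i.e. evaluation at 1, sees all of H^*
    through the action: eps(a ◁ h) = a(h).  Applying eps to the cocycle attached
    to alpha therefore gives alpha back (eps(alpha^-1) = 1).  Conversely, from a
    cocycle r put alpha = eps o r.  Applying eps to
    r(gh) = (r(g) ◁ h_(1)) r(h_(2)) yields alpha(gh) = (r(g) alpha)(h), that is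
    alpha ◁ g = r(g) alpha ([act_counit_comp]).  Finally alpha is invertible in
    H^*: eps is an algebra map, so composition with it carries the convolution
    inverse [rinv r] of r to a convolution inverse of alpha, and convolution is
    the product of H^* ([counit_comp_conv]).  Hence r(g) = (alpha ◁ g) alpha^-1. *)

Section CoboundaryCocycle.
Variables (K : fieldType) (H : finHopfType K) (B : bcAlgType H).
Implicit Types (g h : H) (a b c : B).

(** The two elements are meant to be mutually inverse; B carries no inversion
    operation, so the inverse is an argument. *)
Definition coboundary a a' h : B := (a ◁ h) * a'.

Lemma psi_coboundary a a' b : psi (coboundary a a') b = a * b * a'.
Proof.
rewrite (dy_braid_comm a b) mulr_swl.
by apply: eq_swd => b0 b1; rewrite /coboundary mulrA.
Qed.

(** In the cocycle identity the middle factors (a' ◁ h_(2)) (a ◁ h_(3)) collapse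
    to (a' a) ◁ h_(2) = eps(h_(2)); the map psi is conjugation by a, so
    conjugation by a' inverts it. *)
Lemma coboundary_cocycle a a' :
  a * a' = 1 -> a' * a = 1 -> is_cocycle (coboundary a a').
Proof.
move=> aa' a'a; split.
- by rewrite /coboundary; lin.
- by rewrite /coboundary dy_act1.
- move=> g h; rewrite /coboundary.
  under [RHS]eq_swd => h1 h2 do rewrite dy_mul_act mulr_swl.
  rewrite [RHS](coassocS (F := fun x y z =>
    (a ◁ g ◁ x) * (a' ◁ y) * ((a ◁ z) * a'))); try by lin.
  rewrite -[LHS](counitrS (f := fun h => (a ◁ (g * h)) * a')); last by lin.
  apply: eq_swd => x k.
  under [RHS]eq_swd => y z do rewrite mulrA -[_ * _ * (a ◁ z)]mulrA.
  rewrite -mulr_swl -mulr_swr -dy_mul_act a'a dy_one_act dy_actM.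
  by rewrite -scalerAr mulr1 scalerAl.
- exists (fun b => a' * b * a) => b; rewrite psi_coboundary.
    by rewrite !mulrA a'a mul1r -mulrA a'a mulr1.
  by rewrite !mulrA aa' mul1r -mulrA aa' mulr1.
Qed.

(** psi conjugates the second factor by a, and its left-hand a cancels the a'
    of the first factor. *)
Lemma bullet_coboundary a a' b b' h : a' * a = 1 ->
  bullet (coboundary a a') (coboundary b b') h =
  coboundary (a * b) (b' * a') h.
Proof.
move=> a'a; rewrite /coboundary dy_mul_act mulr_swl; apply: eq_swd => h1 h2.
by rewrite psi_coboundary !mulrA -[_ * a' * a]mulrA a'a mulr1.
Qed.

End CoboundaryCocycle.

Section DualCocycle.
Variables (K : fieldType) (H : finHopfType K).
Implicit Types (g h : H).

Local Notation dualB := (hdual H : bcAlgType H).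

Lemma counit_coboundary (a a' : hdual H) h :
  counit (coboundary (B := dualB) a a' h : hdual H) = a h * counit a'.
Proof.
rewrite /coboundary counitM; congr (_ * _).
by rewrite -[LHS]/(hdual_act a h 1) hdual_actE mulr1.
Qed.

(** The candidate alpha recovered from a cocycle r. *)
Definition counit_comp (r : H -> dualB) : hdual H :=
  linfun (fun h => counit (r h : hdual H) : K^o).

Lemma counit_compE (r : H -> dualB) h :
  linear r -> counit_comp r h = counit (r h : hdual H).
Proof. by move=> lr; rewrite /counit_comp linfunE //; lin. Qed.

(** Composition with the algebra map eps : H^* -> K turns convolution of maps
    H -> H^* into convolution of functionals, which is the product of H^*. *)
Lemma counit_comp_conv (r s : H -> dualB) : linear r -> linear s ->
  (forall h, \sw_(h1, h2 <- comul h) r h1 * s h2 = counit h *: 1) ->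
  counit_comp r * counit_comp s = 1.
Proof.
move=> lr ls rs; apply/lfunP => h; rewrite hdualME hdual1E.
transitivity (counit ((counit h *: 1) : hdual H) : K^o).
  rewrite -rs (lin_sw _ _ (@counit_lin K (hdual H))); apply: eq_swd => h1 h2.
  by rewrite counitM !counit_compE.
by rewrite (linZ (@counit_lin K (hdual H))) counit1 scale_regE mulr1.
Qed.

(** The counit applied to the cocycle identity: eps(r(g) ◁ h_(1)) = r(g)(h_(1)),
    so its right-hand side becomes the value at h of the product r(g) alpha. *)
Lemma act_counit_comp (r : H -> dualB) g : is_cocycle r ->
  hdual_act (counit_comp r) g = r g * counit_comp r.
Proof.
move=> [lr r1 rM _]; apply/lfunP => h.
rewrite hdual_actE counit_compE // rM hdualME.
rewrite (lin_sw _ _ (@counit_lin K (hdual H))); apply: eq_swd => h1 h2.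
rewrite counitM counit_compE //; congr (_ * _).
by rewrite -[LHS]/(hdual_act (r g) h1 1) hdual_actE mulr1.
Qed.

(** Counitality is the unitality of r; the inverse comes from the convolution
    inverse of r. *)
Lemma counit_comp_counital_unit (r : H -> dualB) :
  is_cocycle r -> counital_unit (counit_comp r).
Proof.
move=> [lr r1 rM _]; apply/andP; split; last first.
  by rewrite -[counit _]/(counit_comp r 1) counit_compE // r1 counit1.
apply/unitrP; exists (counit_comp (rinv r)).
have lri := rinv_lin lr.
by split; apply: counit_comp_conv => // h; [apply: rinvl | apply: rinvr].
Qed.

Lemma Gcu_divrr (alpha : Gcu (hdual H)) : val alpha * (val alpha)^-1 = 1.
Proof. by rewrite mulrV //; case/andP: (valP alpha). Qed.

Lemma Gcu_mulVr (alpha : Gcu (hdual H)) : (val alpha)^-1 * val alpha = 1.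
Proof. by rewrite mulVr //; case/andP: (valP alpha). Qed.

Definition cocycle_of (alpha : Gcu (hdual H)) : Z1 dualB :=
  MkZ1 (coboundary_cocycle (B := dualB) (Gcu_divrr alpha) (Gcu_mulVr alpha)).

Lemma cocycle_ofM : {morph cocycle_of : alpha beta / (alpha * beta)%g}.
Proof.
move=> alpha beta; apply: Z1_ext => h.
rewrite /= bullet_coboundary ?Gcu_mulVr // -invrM //.
  by case/andP: (valP alpha).
by case/andP: (valP beta).
Qed.

HB.instance Definition _ :=
  isMultiplicative.Build (Gcu (hdual H)) (Z1 dualB) cocycle_of cocycle_ofM.

Definition unit_of_cocycle (r : Z1 dualB) : Gcu (hdual H) :=
  exist _ (counit_comp r) (counit_comp_counital_unit (Z1P r)).

Lemma cocycle_ofK : cancel cocycle_of unit_of_cocycle.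
Proof.
move=> alpha; apply: val_inj; apply/lfunP => h.
have [lr _ _ _] := Z1P (cocycle_of alpha).
rewrite [LHS]counit_compE // counit_coboundary.
by case/andP: (counital_unitV (valP alpha)) => _ /eqP ->; rewrite mulr1.
Qed.

Lemma unit_of_cocycleK : cancel unit_of_cocycle cocycle_of.
Proof.
move=> r; apply: Z1_ext => h.
rewrite -[LHS]/(hdual_act (counit_comp r) h * (counit_comp r)^-1).
rewrite (act_counit_comp _ (Z1P r)) mulrK //.
by case/andP: (counit_comp_counital_unit (Z1P r)).
Qed.

End DualCocycle.

Theorem proposition5p9 (K : fieldType) (H : finHopfType K) :
  exists rho : {multiplicative Gcu (hdual H) -> Z1 (hdual H : bcAlgType H)},
    bijective rho /\
    forall alpha : Gcu (hdual H),
      (forall h : H, rho alpha h =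
         \sw_(alpha1, alpha2 <- comul (val alpha))
           (alpha1 h : K) *: (alpha2 * (val alpha)^-1)) /\
      (forall a : hdual H,
         psi (rho alpha) a = val alpha * a * (val alpha)^-1).
Proof.
exists (@cocycle_of K H); split.
  by exists (@unit_of_cocycle K H);
    [apply: cocycle_ofK | apply: unit_of_cocycleK].
move=> alpha; split=> [h | a]; last exact: psi_coboundary.
rewrite -[LHS]/(hdual_act (val alpha) h * (val alpha)^-1) mulr_swl.
by apply: eq_swd => a1 a2; rewrite scalerAl.
Qed.
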